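(* Let $p \neq 2$ be a prime, let $G$ be a finite $p$-group, and let $n$ be a non-negative integer such that $|G'| > p^{n(n-1)/2}$. Then there do not exist two proper subgroups $H_1, H_2$ of $G$ such that every element $x \in G$ with $b(x) \geq n$ lies in $H_1 \cup H_2$.
   Context: $G'$ denotes the derived subgroup of $G$. For $x$ in a finite $p$-group $G$, the breadth $b(x)$ is defined by $|G : C_G(x)| = p^{b(x)}$, where $C_G(x)$ is the centralizer of $x$ in $G$. *)

(* Defs.v *)
From mathcomp Require Import all_boot all_fingroup all_solvable.
Set Implicit Arguments. Unset Strict Implicit. Unset Printing Implicit Defensive.
Import GroupScope.

Definition breadth (p : nat) (gT : finGroupType) (G : {group gT}) (x : gT) : nat :=
  logn p #|G : 'C_G[x]|.

(* Main.v *)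
(** Induction on |G|, bounding |G'| by p^(n(n-1)/2) whenever two proper
    subgroups H1, H2 contain all elements of breadth at least n.  Enlarging
    them, take H1 <> H2 maximal and put K = H1 :&: H2.  As p is odd, there are
    a maximal M containing K, distinct from H1 and H2, and an element t
    outside H1, H2 and M.  Since M/M' is an abelian maximal subgroup of G/M',
    |G' : M'| <= p^b(t) <= p^(n-1).  Let D be the set of elements of M that
    are central in G modulo M'.  An element y of M \ K has breadth less than n
    in G; either C_G(y) <= M, and its breadth drops by one in M, or y commutes
    with something outside M, and then y lies in D.  If D <> M, the proper
    subgroups K and D of M contain all elements of breadth at least n-1 in M,
    and induction applies to M and n-1.  If D = M then G' = M', and induction
    applies to M, K and n. *)

Require Import Defs.
From mathcomp Require Import all_boot all_fingroup all_solvable.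
Import GroupScope.

Set Implicit Arguments. Unset Strict Implicit. Unset Printing Implicit Defensive.

(** * Maximal subgroups, and a bound on the derived subgroup *)

Section Maximal.

Variable gT : finGroupType.
Implicit Types (A G H K M : {group gT}) (p n : nat).

Lemma maximal_overgroup G M H :
  maximal M G -> M \subset H -> H \subset G -> H :=: M \/ H :=: G.
Proof.
move=> /maxgroupP[_ maxM] sMH; rewrite subEproper => /predU1P[->|prH]; first by right.
by left; apply: maxM.
Qed.

Lemma maximal_joing_cycle G M x :
  maximal M G -> x \in G -> x \notin M -> M <*> <[x]> = G.
Proof.
move=> maxM Gx notMx; have sMG := proper_sub (maxgroupp maxM).
have sYG : M <*> <[x]> \subset G by rewrite join_subG sMG cycle_subG.
have [eqM|//] := maximal_overgroup maxM (joing_subl _ _) sYG.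
by case/negP: notMx; rewrite -eqM mem_gen // inE cycle_id orbT.
Qed.

Lemma exists_maximal_neq G M :
  ~~ cyclic G -> maximal M G -> exists2 H : {group gT}, maximal H G & H :!=: M.
Proof.
move=> ncycG maxM; have /andP[sMG nsGM] := maxgroupp maxM.
have /subsetPn[x Gx notMx] := nsGM.
have : <[x]> \subset G by rewrite cycle_subG.
rewrite subEproper => /predU1P[eqG|prX].
  by case/negP: ncycG; rewrite -eqG cycle_cyclic.
have [eqG|[H maxH sXH]] := maximal_exists (proper_sub prX).
  by case/negP: ncycG; rewrite -eqG cycle_cyclic.
exists H => //; apply: contraNneq notMx => <-.
by rewrite -cycle_subG.
Qed.

(** With [K = H1 :&: H2], the quotient [G / K] is elementary abelian of order p^2, so its p + 1 >= 4
    lines leave at least two besides those of [H1] and [H2]. For [a] in [H1] and [b] in [H2], both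
    outside [K], the products [a * b] and [a * b^-1] lie on two such lines; the first gives [M], the
    second is [t]. *)
Lemma exists_third_maximal p G H1 H2 :
    prime p -> p != 2 -> p.-group G ->
    maximal H1 G -> maximal H2 G -> H1 :!=: H2 ->
  exists M : {group gT},
    [/\ maximal M G, M :&: H1 = H1 :&: H2, M :&: H2 = H1 :&: H2,
        H1 :&: H2 \proper M
      & exists2 t, t \in G & [&& t \notin H1, t \notin H2 & t \notin M]].
Proof.
move=> p_pr p_neq2 pG maxH1 maxH2 neqH.
have [nsH1 nsH2] := (p_maximal_normal pG maxH1, p_maximal_normal pG maxH2).
have [iH1 iH2] := (p_maximal_index pG maxH1, p_maximal_index pG maxH2).
have [sH1 sH2] := (normal_sub nsH1, normal_sub nsH2).
have nsub H H' : maximal H G -> maximal H' G -> H :!=: H' -> ~~ (H \subset H').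
  move=> maxH maxH' neq; apply/negP => sHH'.
  have /andP[sH'G nsGH'] := maxgroupp maxH'.
  have [eqH|eqG] := maximal_overgroup maxH sHH' sH'G; first by rewrite eqH eqxx in neq.
  by rewrite eqG subxx in nsGH'.
have /subsetPn[a H1a notH2a] := nsub _ _ maxH1 maxH2 neqH.
have /subsetPn[b H2b notH1b] : ~~ (H2 \subset H1).
  by apply: nsub => //; rewrite eq_sym.
have [Ga Gb] := (subsetP sH1 a H1a, subsetP sH2 b H2b).
pose K := (H1 :&: H2)%G.
have nsK : K <| G by rewrite normalI.
have sKG := normal_sub nsK.
have abelQ : p.-abelem (G / K).
  have sPhiK : 'Phi(G) \subset K by rewrite subsetI !Phi_sub_max.
  rewrite -(isog_abelem (third_isog sPhiK (Phi_normal G) nsK)).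
  by apply/quotient_abelem/Phi_quotient_abelem.
have eqH12 : H1 * H2 = G.
  by apply: mulg_normal_maximal => //; apply/subsetPn; exists b.
have iK : #|G : K| = (p * p)%N.
  have iKH1 : #|H1 : K| = p.
    by rewrite indexgI -iH2 -eqH12 (normC (subset_trans sH1 (normal_norm nsH2))) indexMg.
  by rewrite -(Lagrange_index sH1 (subsetIl _ _)) iKH1 iH1.
pose M := (K <*> <[a * b]>)%G.
have sKM : K \subset M := joing_subl _ _.
have Mab : a * b \in M by rewrite mem_gen // inE cycle_id orbT.
have notH1ab : a * b \notin H1 by rewrite groupMl.
have notH2ab : a * b \notin H2 by rewrite groupMr.
have sMG : M \subset G by rewrite join_subG sKG cycle_subG groupM.
have prKM : K \proper M.
  by apply/properP; split=> //; exists (a * b) => //; rewrite inE (negPf notH1ab).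
(* If [M] were [G], the image of [a * b] would generate [G / K], which is not cyclic. *)
have prMG : M \proper G.
  rewrite properE sMG; apply/negP => sGM.
  have : cyclic (G / K).
    have -> : G / K = <[a * b]> / K.
      apply/eqP; rewrite eqEsubset; apply/andP; split; last first.
        by rewrite quotientS // cycle_subG groupM.
      apply: subset_trans (quotientS _ sGM) _.
      rewrite quotientYidl // cycle_subG.
      by rewrite (subsetP (normal_norm nsK)) ?groupM.
    by rewrite quotient_cyclic ?cycle_cyclic.
  rewrite (abelem_cyclic abelQ) card_quotient ?normal_norm // iK.
  by rewrite lognM ?prime_gt0 // logn_prime // eqxx.
(* Both indices are nontrivial powers of p, and their product is p^2. *)
have iM : #|G : M| = p /\ #|M : K| = p.
  have := Lagrange_index sMG sKM; rewrite iK => iMK.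
  have pnatGM : p.-nat #|G : M| by exact: pnat_dvd (dvdn_indexg _ _) pG.
  have pnatMK : p.-nat #|M : K|.
    exact: pnat_dvd (dvdn_indexg _ _) (pgroupS sMG pG).
  have gM : 1 < #|G : M| by rewrite indexg_gt1; case/andP: prMG.
  have gK : 1 < #|M : K| by rewrite indexg_gt1; case/andP: prKM.
  have dvp m : p.-nat m -> 1 < m -> p %| m.
    move=> /p_natP[[|k] ->] //; by rewrite expnS dvdn_mulr.
  have /dvdnP[c1 e1] := dvp _ pnatGM gM; have /dvdnP[c2 e2] := dvp _ pnatMK gK.
  move: iMK; rewrite e1 e2 mulnACA -[RHS]mul1n => /eqP.
  rewrite eqn_pmul2r ?muln_gt0 ?prime_gt0 // muln_eq1 => /andP[/eqP-> /eqP->].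
  by rewrite mul1n.
have [iGM iMK] := iM.
have maxM : maximal M G by apply: p_index_maximal; rewrite ?iGM.
have maxK : maximal K M by apply: p_index_maximal; rewrite ?iMK.
have eqMH1 : M :&: H1 = K.
  have [| |//|eqM] := maximal_overgroup (H := (M :&: H1)%G) maxK.
  - by rewrite subsetI sKM subsetIl.
  - exact: subsetIl.
  by move: Mab; rewrite -eqM inE (negPf notH1ab) andbF.
have eqMH2 : M :&: H2 = K.
  have [| |//|eqM] := maximal_overgroup (H := (M :&: H2)%G) maxK.
  - by rewrite subsetI sKM subsetIr.
  - exact: subsetIl.
  by move: Mab; rewrite -eqM inE (negPf notH2ab) andbF.
exists M; split=> //; exists (a * b^-1); first by rewrite groupM ?groupV.
rewrite groupMl ?groupV // notH1b groupMr ?groupV // notH2a /=.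
apply/negP => Mt.
(* The quotient of [a * b] by [a * b^-1] is a conjugate of [b ^+ 2], and [M] is normal. *)
have Mb2 : b ^+ 2 \in M.
  rewrite -(memJ_norm _ (subsetP (normal_norm (p_maximal_normal pG maxM)) _ (groupVr Ga))).
  have -> : (b ^+ 2) ^ a^-1 = (a * b) * (a * b^-1)^-1.
    by rewrite conjgE invgK invMg invgK expgS expg1 !mulgA.
  by rewrite groupM ?groupV.
have oddb : odd #[b].
  have /p_natP[k ->] := mem_p_elt pG Gb.
  by rewrite oddX; case: (even_prime p_pr) p_neq2 => [->|->]; rewrite ?orbT.
have Mb : b \in M.
  (* Since [#[b]] is odd, this exponent is an inverse of 2 modulo [#[b]]. *)
  have -> : b = (b ^+ 2) ^+ (#[b].+1)./2.
    rewrite -expgM mul2n -[X in b ^+ X]add0n.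
    have -> : 0 = odd #[b].+1 by rewrite /= oddb.
    by rewrite odd_double_half expgS expg_order mulg1.
  by rewrite groupX.
have : b \in M :&: H2 by rewrite inE Mb.
by rewrite eqMH2 inE (negPf notH1b).
Qed.

(** As [A] is abelian and normal, c |-> [t, c] is an endomorphism of [A]. Its image [S] is
    normalized by [t] and centralized by [A], hence normal in [G], and [t] commutes with [A] modulo
    [S]; so [S] contains the derived subgroup. *)
Lemma card_der1_leq_class A G t :
    abelian A -> A <| G -> t \in G -> A <*> <[t]> = G ->
  #|G^`(1)| <= #|t ^: G|.
Proof.
move=> cAA nsAG Gt eqG; have [sAG nAG] := andP nsAG.
pose S := [set [~ t, c] | c in A].
have nAt : t \in 'N(A) by apply: subsetP Gt.
have sSA : S \subset A.
  apply/subsetP => _ /imsetP[c Ac ->].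
  by rewrite commgEr groupM // memJ_norm ?groupV.
have gS : group_set S.
  apply/group_setP; split; first by apply/imsetP; exists 1; rewrite ?comm1g ?commg1.
  move=> _ _ /imsetP[c Ac ->] /imsetP[d Ad ->].
  apply/imsetP; exists (d * c); first exact: groupM.
  rewrite commgMJ; congr (_ * _); apply/esym/conjg_fixP/commgP.
  by apply: (centsP cAA) => //; apply: (subsetP sSA); apply/imsetP; exists d.
pose Sg := Group gS.
have nSG : G \subset 'N(Sg).
  rewrite -eqG join_subG cents_norm; last by rewrite centsC (subset_trans sSA).
  rewrite cycle_subG; apply/normP/eqP; rewrite eqEcard cardJg leqnn andbT.
  apply/subsetP => _ /imsetP[_ /imsetP[c Ac ->] ->].
  rewrite conjRg conjgE mulKg; apply/imsetP; exists (c ^ t) => //.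
  by rewrite memJ_norm.
have sG'S : G^`(1) \subset Sg.
  apply: der1_min => //; rewrite -eqG quotientY; last 2 first.
  - exact: subset_trans sAG nSG.
  - by rewrite cycle_subG (subsetP nSG).
  rewrite abelianY quotient_abelian // quotient_abelian ?cycle_abelian // !andTb.
  rewrite quotient_cycle ?(subsetP nSG) // cycle_subG.
  apply/centP => _ /morphimP[c Nc Ac ->]; apply/commgP.
  rewrite -morphR //; last by rewrite (subsetP nSG).
  by apply/eqP/coset_id; apply/imsetP; exists c.
apply: leq_trans (subset_leq_card sG'S) _.
(* The translate of [S] by [t] consists of conjugates of [t], because t [t, c] = t^c. *)
have -> : #|Sg| = #|[set t * u | u in S]| by rewrite (card_imset _ (mulgI t)).
apply/subset_leq_card/subsetP => _ /imsetP[_ /imsetP[c Ac ->] ->].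
by rewrite -conjg_mulR memJ_class // (subsetP sAG).
Qed.

End Maximal.

(** * Breadth in a maximal subgroup, and the induction *)

Section Breadth.

Variable gT : finGroupType.
Implicit Types (G H M : {group gT}) (p n : nat).

Lemma card_class_breadth p G x : p.-group G -> #|x ^: G| = (p ^ breadth p G x)%N.
Proof.
move=> pG; rewrite /breadth -p_part -index_cent1 part_pnat_id //.
exact: pnat_dvd (dvdn_indexg _ _) pG.
Qed.

Lemma breadthS p G M x :
  prime p -> p.-group G -> M \subset G -> breadth p M x <= breadth p G x.
Proof.
move=> p_pr pG sMG; rewrite -(leq_exp2l _ _ (prime_gt1 p_pr)).
rewrite -!card_class_breadth ?(pgroupS sMG) //.
exact/subset_leq_card/imsetS.
Qed.

Lemma card_der1_maximal p G M t :
    p.-group G -> maximal M G -> t \in G -> t \notin M ->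
  #|G^`(1)| <= #|M^`(1)| * p ^ breadth p G t.
Proof.
move=> pG maxM Gt notMt.
have nsMG := p_maximal_normal pG maxM; have sMG := normal_sub nsMG.
have nsM'G : M^`(1) <| G := gFnormal_trans _ nsMG.
have nM'G := normal_norm nsM'G.
have eqG := maximal_joing_cycle maxM Gt notMt.
rewrite -(Lagrange (dergS 1 sMG)) leq_mul2l -card_quotient; last first.
  exact: subset_trans (der_sub _ _) nM'G.
rewrite quotient_der //.
rewrite -card_class_breadth //.
apply/orP; right.
apply: leq_trans (_ : #|(coset M^`(1) t) ^: (G / M^`(1))| <= _).
  apply: (card_der1_leq_class (A := (M / M^`(1))%G)).
  - exact: sub_der1_abelian.
  - exact: quotient_normal.
  - exact: mem_quotient.
  - rewrite -quotient_cycle ?(subsetP nM'G) // -quotientY ?eqG //.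
      exact: subset_trans nM'G.
    by rewrite cycle_subG (subsetP nM'G).
(* The class of the image of [t] is contained in the image of the class of [t]. *)
apply: leq_trans (leq_imset_card (coset M^`(1)) _).
apply/subset_leq_card/subsetP => _ /imsetP[_ /morphimP[g Ng Gg ->] ->].
rewrite -morphJ ?(subsetP nM'G t) //.
by apply: imset_f; rewrite memJ_class.
Qed.

Lemma breadth_maximal p G M y :
    prime p -> p.-group G -> maximal M G -> 'C_G[y] \subset M ->
  breadth p G y = (breadth p M y).+1.
Proof.
move=> p_pr pG maxM sCM; have sMG := normal_sub (p_maximal_normal pG maxM).
have eqC : 'C_G[y] = 'C_M[y].
  apply/eqP; rewrite eqEsubset subsetI sCM subsetIr.
  exact: setSI.
rewrite /breadth eqC -(Lagrange_index sMG (subsetIl _ _)).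
by rewrite (p_maximal_index pG maxM) lognM ?(prime_gt0 p_pr) // logn_prime // eqxx.
Qed.

(** Some [g] outside [M] commutes with [y], while [M] commutes with [y] modulo its derived subgroup;
    together [M] and [g] generate [G]. *)
Lemma coset_der1_center p G M y :
    p.-group G -> maximal M G -> y \in M -> ~~ ('C_G[y] \subset M) ->
  coset M^`(1) y \in 'Z(G / M^`(1)).
Proof.
move=> pG maxM My /subsetPn[g /setIP[Gg /cent1P cgy] notMg].
have nsMG := p_maximal_normal pG maxM; have sMG := normal_sub nsMG.
have nM'G : G \subset 'N(M^`(1)) := normal_norm (gFnormal_trans _ nsMG).
have Gy := subsetP sMG y My.
rewrite inE mem_quotient //= -sub_cent1.
rewrite -(maximal_joing_cycle maxM Gg notMg) quotientY; last 2 first.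
- exact: subset_trans nM'G.
- by rewrite cycle_subG (subsetP nM'G).
rewrite join_subG quotient_cycle ?(subsetP nM'G) // cycle_subG.
apply/andP; split; last first.
  by apply/cent1P; rewrite /commute -!morphM ?(subsetP nM'G) // cgy.
rewrite sub_cent1 (subsetP (sub_der1_abelian (subxx M^`(1)))) //.
exact: mem_quotient.
Qed.

(** The quotient of [G] is generated by a central subgroup and one more element, so it is
    abelian. *)
Lemma der1_maximal_eq p G M :
    p.-group G -> maximal M G -> M / M^`(1) \subset 'Z(G / M^`(1)) ->
  G^`(1) \subset M^`(1).
Proof.
move=> pG maxM sMZ.
have nsMG := p_maximal_normal pG maxM; have sMG := normal_sub nsMG.
have nsM'G : M^`(1) <| G := gFnormal_trans _ nsMG.
have nM'G := normal_norm nsM'G.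
have /andP[_ /subsetPn[g Gg notMg]] := maxgroupp maxM.
apply: der1_min => //; rewrite -(maximal_joing_cycle maxM Gg notMg) quotientY.
- rewrite abelianY sub_der1_abelian // quotient_abelian ?cycle_abelian //=.
  rewrite centsC; apply: subset_trans sMZ _; rewrite subIset //.
  by rewrite centS ?orbT // quotientS // cycle_subG.
- exact: subset_trans nM'G.
- by rewrite cycle_subG (subsetP nM'G).
Qed.

Lemma card_der1_two_subgroup_cover p G n H1 H2 :
    prime p -> p != 2 -> p.-group G -> H1 \proper G -> H2 \proper G ->
    (forall x, x \in G -> n <= breadth p G x -> (x \in H1) || (x \in H2)) ->
  #|G^`(1)| <= p ^ (n * (n - 1) %/ 2).
Proof.
move=> p_pr p_neq2.
have [m] := ubnP #|G|; elim: m => // m IHm in G n H1 H2 * => leGm pG prH1 prH2 cov.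
have p_gt0 := prime_gt0 p_pr.
(* A cyclic p-group has no two distinct maximal subgroups, so this case is settled apart. *)
have [cycG|ncycG] := boolP (cyclic G).
  by rewrite (derG1P (cyclic_abelian cycG)) cards1 expn_gt0 p_gt0.
have maxP (H : {group gT}) : H \proper G -> exists2 N : {group gT}, maximal N G & H \subset N.
  move=> prH; have [eqG|[N]] := maximal_exists (proper_sub prH); last by exists N.
  by rewrite eqG properxx in prH.
wlog [maxH1 maxH2 neqH] : H1 H2 prH1 prH2 cov /
    [/\ maximal H1 G, maximal H2 G & H1 :!=: H2].
  move=> Wlog; have [N1 maxN1 sHN1] := maxP H1 prH1.
  have [N2 maxN2 sHN2] := maxP H2 prH2.
  have [N maxN neqN] := exists_maximal_neq ncycG maxN1.
  have prN (L : {group gT}) : maximal L G -> L \proper G := @maxgroupp _ _ _.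
  (* If both enlargements coincide, [N1] alone is a cover and any other maximal [N] may serve as the
     second subgroup. *)
  have [eqN|neqN12] := eqVneq (N1 : {set gT}) N2.
    apply: (Wlog N1 N); rewrite ?prN //; last by rewrite eq_sym.
    move=> x Gx /(cov x Gx)/orP[/(subsetP sHN1)->//|/(subsetP sHN2)].
    by rewrite -eqN => ->.
  apply: (Wlog N1 N2); rewrite ?prN // => x Gx /(cov x Gx)/orP[] Hx.
    by rewrite (subsetP sHN1).
  by rewrite (subsetP sHN2) ?orbT.
have [M [maxM eqMH1 eqMH2 prKM [t Gt /and3P[notH1t notH2t notMt]]]] :=
  exists_third_maximal p_pr p_neq2 pG maxH1 maxH2 neqH.
have sMG := normal_sub (p_maximal_normal pG maxM).
have leMm : #|M| < m by apply: leq_trans (proper_card (maxgroupp maxM)) _.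
have pM := pgroupS sMG pG.
have outK y : y \in M -> y \notin H1 :&: H2 -> breadth p G y < n.
  move=> My notKy; rewrite ltnNge; apply: contra notKy => /(cov y (subsetP sMG y My)).
  by case/orP=> Hy; [rewrite -eqMH1 | rewrite -eqMH2]; rewrite inE My.
have ltbt : breadth p G t < n.
  by rewrite ltnNge; apply/negP => /(cov t Gt); rewrite (negPf notH1t) (negPf notH2t).
pose D := (M :&: coset M^`(1) @*^-1 'Z(G / M^`(1)))%G.
have nM'M : M \subset 'N(M^`(1)) := der_norm 1 M.
have [sMD|nsMD] := boolP (M \subset D).
  have sG'M' : G^`(1) \subset M^`(1).
    apply: (der1_maximal_eq pG maxM); apply/subsetP => _ /morphimP[y Ny My ->].
    by have /setIP[_ /morphpreP[]]  := subsetP sMD y My.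
  apply: leq_trans (subset_leq_card sG'M') _.
  (* [K] plays both roles: outside it, elements of [M] have breadth below [n] in [G], hence in
     [M]. *)
  apply: (IHm M n (H1 :&: H2)%G (H1 :&: H2)%G) => // y My nby.
  rewrite orbb; apply: contraLR nby => /outK ltb; rewrite -ltnNge.
  apply: leq_ltn_trans (ltb My).
  exact: breadthS.
have prD : D \proper M by rewrite properE subsetIl.
(* The case [n = 0] contradicts [ltbt]. From here [n] is one less than before, so [t] has breadth at
   most [n]. *)
case: n => // n in cov outK ltbt *.
apply: leq_trans (card_der1_maximal pG maxM Gt notMt) _.
have IHM : #|M^`(1)| <= p ^ (n * (n - 1) %/ 2).
  apply: (IHm M n (H1 :&: H2)%G D) => // y My nby.
  have [//|notKy] := boolP (y \in H1 :&: H2).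
  have /= := outK y My notKy.
  have [sCM|nsCM] := boolP ('C_G[y] \subset M).
    by rewrite (breadth_maximal p_pr pG maxM sCM) ltnS ltnNge nby.
  move=> _; rewrite inE My /=; apply/morphpreP; split; first exact: (subsetP nM'M).
  exact: (coset_der1_center pG maxM).
apply: leq_trans (leq_mul IHM (leq_pexp2l p_gt0 (ltbt : breadth p G t <= n))) _.
(* The exponents add up by Pascal's rule: C(n, 2) + n = C(n + 1, 2). *)
rewrite -expnD leq_exp2l ?prime_gt1 // subn1 /=.
by rewrite subn1 /= !divn2 -!bin2 binS bin1 addnC.
Qed.

End Breadth.

Theorem theorem1p2 (p : nat) (gT : finGroupType) (G : {group gT}) (n : nat) :
  prime p -> p != 2 -> p.-group G ->
  #|G^`(1)| > p ^ (n * (n - 1) %/ 2) ->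
  ~ (exists H1 H2 : {group gT},
       [/\ H1 \proper G, H2 \proper G &
           forall x, x \in G -> breadth p G x >= n -> (x \in H1) || (x \in H2)]).
Proof.
move=> p_pr p_neq2 pG ltG' [H1 [H2 [prH1 prH2 cov]]].
by move: ltG'; rewrite ltnNge (card_der1_two_subgroup_cover p_pr p_neq2 pG prH1 prH2 cov).
Qed.
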